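(* Let $\beta$ be a Parry number and $\chi$ a beta-conjugate of $\beta$ whose minimal polynomial $g(X)\in\mathbb{Z}[X]$ (monic, of degree $n$) is non-reciprocal. Let $\chi_0=\chi,\chi_1,\ldots,\chi_{n-1}$ be the roots of $g$. Then either $|\chi_j|>1+\frac{0.1}{n}$ for at least one $j\in\{0,\ldots,n-1\}$, or $|\chi_j|\leq 1+\frac{0.1}{n}$ for all $j$ and in that case $g(X)=-g^*(X)$.
   Context: For non-integer $\beta>1$, $d_\beta(1)=0.t_1t_2\ldots$ with $t_1=\lfloor\beta\rfloor$, $t_{j+1}=\lfloor\beta T_\beta^j(1)\rfloor$, $T_\beta(x)=\beta x-\lfloor\beta x\rfloor$; $\beta$ is a Parry number if $(t_i)$ is eventually periodic. Parry polynomial: if $t_i=0$ for $i>m$, $t_m\neq0$: $n_\beta^*(X)=X^m-\sum_{i=1}^mt_iX^{m-i}$; otherwise with minimal preperiod $m\ge0$ and period $p+1$: if $m\ge1$, $n_\beta^*(X)=X^{m+p+1}-\sum_{i=1}^{m+p+1}t_iX^{m+p+1-i}-X^m+\sum_{i=1}^mt_iX^{m-i}$; if $m=0$, $n_\beta^*(X)=X^{p+1}-\sum_{i=1}^pt_iX^{p+1-i}-(1+t_{p+1})$. A beta-conjugate of $\beta$ is a root of $n_\beta^*$ which is not a root of the minimal polynomial of $\beta$. For $R$ of degree $n$, $R^*(X)=X^nR(1/X)$; $R$ is reciprocal if $R=R^*$. *)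

(* Defs.v *)
From HB Require Import structures.
From mathcomp Require Import all_boot all_order all_algebra.
From mathcomp Require Import reals complex.

Set Implicit Arguments.
Unset Strict Implicit.
Unset Printing Implicit Defensive.

Import Order.TTheory GRing.Theory Num.Theory.
Local Open Scope ring_scope.

Definition beta_transform (R : realType) (beta x : R) : R :=
  beta * x - (Num.floor (beta * x))%:~R.

(* Digits are numbered from 1: t_1, t_2, ...; the value at index 0 is junk
   and is never used below. *)
Definition beta_digit (R : realType) (beta : R) (i : nat) : int :=
  Num.floor (beta * iter i.-1 (beta_transform beta) 1).

(* The digit sequence has preperiod (at most) m and period p + 1. *)
Definition beta_periodic (R : realType) (beta : R) (m p : nat) : Prop :=
  forall i : nat, (m < i)%N ->
    beta_digit beta (i + p.+1) = beta_digit beta i.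

Definition parry_number (R : realType) (beta : R) : Prop :=
  [/\ 1 < beta, beta \isn't a Num.int & exists m p, beta_periodic beta m p].

Definition beta_finite (R : realType) (beta : R) (m : nat) : Prop :=
  [/\ (0 < m)%N, beta_digit beta m != 0
    & forall i : nat, (m < i)%N -> beta_digit beta i = 0].

Definition beta_min_periodic (R : realType) (beta : R) (m p : nat) : Prop :=
  [/\ forall k, ~ beta_finite beta k, beta_periodic beta m p
    & forall m' p' : nat,
        beta_periodic beta m' p' -> (m <= m')%N /\ (p <= p')%N].

Variant parry_polynomial (R : realType) (beta : R) : {poly int} -> Prop :=
| ParryFinite m of beta_finite beta m :
    parry_polynomial beta
      ('X^m - \sum_(1 <= i < m.+1) beta_digit beta i *: 'X^(m - i))
| ParryPreperiodic m p of (0 < m)%N & beta_min_periodic beta m p :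
    parry_polynomial beta
      ('X^(m + p.+1)
       - \sum_(1 <= i < (m + p.+1).+1) beta_digit beta i *: 'X^(m + p.+1 - i)
       - 'X^m
       + \sum_(1 <= i < m.+1) beta_digit beta i *: 'X^(m - i))
| ParryPeriodic p of beta_min_periodic beta 0 p :
    parry_polynomial beta
      ('X^(p.+1) - \sum_(1 <= i < p.+1) beta_digit beta i *: 'X^(p.+1 - i)
       - (1 + beta_digit beta p.+1)%:P).

Definition minimal_polynomial (F : numFieldType) (x : F) (P : {poly rat})
    : Prop :=
  [/\ P \is monic, root (map_poly ratr P) x
    & forall Q : {poly rat}, Q != 0 -> root (map_poly ratr Q) x ->
        (size P <= size Q)%N].

Definition beta_conjugate (R : realType) (beta : R) (chi : R[i]) : Prop :=
  (exists2 N : {poly int}, parry_polynomial beta N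
     & root (map_poly intr N) chi) /\
  (exists2 P : {poly rat}, minimal_polynomial beta P
     & ~~ root (map_poly ratr P) chi).

(* X^n P(1/X) with n = deg P, expanded: each term a_i X^i becomes
   a_i X^(n - i). *)
Definition recip_poly (P : {poly int}) : {poly int} :=
  \sum_(i < size P) P`_i *: 'X^((size P).-1 - i).

(* Main.v *)
(* Suppose all roots of g have modulus at most 1 + 0.1/n. Then |g(0)| < 2, and
   g(0) <> 0 because 0 is not a root of a Parry polynomial, so g(0) = 1 or -1.
   Smyth's argument, with Parseval's inequality alone, bounds the Mahler measure
   M of g from below when g <> g(0) g^*: write g / g^* = f / h, where f and h
   are (up to unimodular constants) the Blaschke products of the roots inside
   and outside the unit disc. Both have constant coefficient of modulus 1/M and
   l^2-norm at most 1, and comparing the first coefficient at which g(0) f and h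
   differ gives M^2 >= 5/4, whereas (1 + 0.1/n)^(2n) < 5/4. The power series are
   replaced by polynomials modulo X^K. *)

Require Import Defs.
From HB Require Import structures.
From mathcomp Require Import all_boot all_order all_algebra.
From mathcomp Require Import reals complex.
From mathcomp Require Import ring.

Set Implicit Arguments.
Unset Strict Implicit.
Unset Printing Implicit Defensive.

Import Order.TTheory GRing.Theory Num.Theory.
Local Open Scope ring_scope.

(** * Power series modulo ['X^k] and truncated Blaschke products *)

Lemma dvdXn_coef (F : fieldType) k (p : {poly F}) :
  reflect (forall i, (i < k)%N -> p`_i = 0) ('X^k %| p).
Proof.
apply: (iffP idP) => [/dvdpP[q ->] i ik|p0]; first by rewrite coefMXn ik.
have -> : p = drop_poly k p * 'X^k.
  rewrite -[LHS](poly_take_drop k) [take_poly k p](_ : _ = 0) ?add0r //.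
  by apply/polyP => i; rewrite coef_take_poly coef0; case: ifP => // /p0.
exact: dvdp_mulIr.
Qed.

Lemma coprimep_coef0 (F : fieldType) k (p : {poly F}) :
  p`_0 != 0 -> coprimep p 'X^k.
Proof.
move=> p0; rewrite coprimep_expr //.
by rewrite -['X]subr0 -polyC0 coprimep_XsubC /root horner_coef0.
Qed.

Section Blaschke.
Variable C : numClosedFieldType.
Implicit Types (c d : C) (w : {poly C}).

(** The cross terms in the squared [i]-th coefficients agree on both sides, so these squares differ
    by [(|c|^2 - |d|^2) (|w_i|^2 - |w_(i-1)|^2)], which telescopes. *)
Lemma linear_isometry_defect c d w K :
  \sum_(i < K.+1) `|(w * (c%:P + d *: 'X))`_i| ^+ 2 =
  \sum_(i < K.+1) `|(w * (d^*%:P + c^* *: 'X))`_i| ^+ 2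
    + (`|c| ^+ 2 - `|d| ^+ 2) * `|w`_K| ^+ 2.
Proof.
have E a b i : (w * (a%:P + b *: 'X))`_i =
    w`_i * a + (if i is j.+1 then w`_j else 0) * b.
  by rewrite mulrDr coefD coefMC -scalerAr coefZ coefMX [b * _]mulrC; case: i.
elim: K => [|K IH].
  rewrite !big_ord1 !E !mul0r !addr0 !normrM norm_conjC; ring.
rewrite big_ord_recr [in RHS]big_ord_recr /= {}IH !E !normCK.
rewrite !rmorphD !rmorphM /= !conjCK; ring.
Qed.

Lemma linear_contraction c d w K : `|d| <= `|c| ->
  \sum_(i < K) `|(w * (d^*%:P + c^* *: 'X))`_i| ^+ 2 <=
  \sum_(i < K) `|(w * (c%:P + d *: 'X))`_i| ^+ 2.
Proof.
case: K => [|K] dc; first by rewrite !big_ord0.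
by rewrite (linear_isometry_defect c) lerDl mulr_ge0 ?exprn_ge0 //
  subr_ge0 lerXn2r ?nnegrE.
Qed.

(** [f] represents the product of the quotients [(d^* + c^* X) / (c + d X)] modulo ['X^K]. Starting
    from 1, each new factor enters through an inverse [u] of its denominator [D] modulo ['X^K], and
    the contraction applied to [w = f * u] keeps the norm at most 1. *)
Lemma blaschke_truncation (I : Type) (s : seq I) (P : pred I) (c d : I -> C) K :
  (forall i, P i -> c i != 0 /\ `|d i| <= `|c i|) ->
  exists2 f : {poly C},
    'X^K %| f * (\prod_(i <- s | P i) ((c i)%:P + d i *: 'X))
            - \prod_(i <- s | P i) ((d i)^*%:P + (c i)^* *: 'X)
    & \sum_(i < K) `|f`_i| ^+ 2 <= 1.
Proof.
move=> cd; elim: s => [|x s [f fD fN]].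
  exists 1; first by rewrite !big_nil mulr1 subrr dvdp0.
  case: K => [|K]; first by rewrite big_ord0 ler01.
  rewrite big_ord_recl big1 ?coef1 ?normr1 ?expr1n ?addr0 // => i _.
  by rewrite coef1 normr0 expr0n.
rewrite !big_cons; case: ifP => Px; last by exists f.
have [c0 dc] := cd _ Px; set D := (c x)%:P + d x *: 'X.
set N := _%:P + (c x)^* *: 'X.
have /Bezout_eq1_coprimepP[[u v] /= uv] : coprimep D 'X^K.
  by rewrite coprimep_coef0 // /D coefD coefC coefZ coefX mulr0 addr0.
have DfE : 'X^K %| f * u * D - f.
  rewrite -[X in _ - X]mulr1 -uv; apply/dvdpP; exists (- f * v); ring.
exists (f * u * N).
  set Ds := \big[_/_]_(_ <- _ | _) _; set Ns := \big[_/_]_(_ <- _ | _) _.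
  have -> : f * u * N * (D * Ds) - N * Ns =
    N * Ds * (f * u * D - f) + N * (f * Ds - Ns) by ring.
  by rewrite dvdp_add ?dvdp_mull.
apply: le_trans (linear_contraction _ _ dc) _.
(* Below index [K], [f * u * D] has the coefficients of [f]. *)
rewrite (le_trans _ fN) // ler_sum // => i _.
have /dvdXn_coef/(_ i (ltn_ord i)) := DfE.
by rewrite coefB => /eqP; rewrite subr_eq0 => /eqP->.
Qed.

End Blaschke.

(** * Reciprocal polynomials and the lower bound for the Mahler measure *)

Lemma recip_poly_coef (p : {poly int}) n i : size p = n.+1 ->
  (recip_poly p)`_i = if (i <= n)%N then p`_(n - i) else 0.
Proof.
move=> sp; rewrite /recip_poly sp /= coef_sum.
under eq_bigr => j _ do rewrite coefZ coefXn.
case: leqP => [lin|ltni].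
  rewrite (bigD1 (Ordinal (leq_subr i n : (n - i < n.+1)%N))) //=.
  rewrite subKn // eqxx mulr1 big1 ?addr0 // => j /eqP jn.
  case: eqP => [E|]; rewrite ?mulr0 //; case: jn; apply: val_inj => /=.
  by rewrite E subKn // -ltnS ltn_ord.
rewrite big1 // => j _; case: eqP => [E|]; rewrite ?mulr0 //.
by move: ltni; rewrite E ltnNge leq_subr.
Qed.

Lemma reverse_prod_XsubC (F : comNzRingType) (s : seq F) :
  \poly_(i < (size s).+1) (\prod_(x <- s) ('X - x%:P))`_(size s - i) =
  \prod_(x <- s) (1 - x *: 'X).
Proof.
elim: s => [|a s IH].
  by rewrite !big_nil; apply/polyP => -[|i]; rewrite coef_poly !coef1.
rewrite !big_cons -IH /=; set p := \prod_(x <- s) _; set n := size s.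
have sp : p`_n.+1 = 0 by rewrite nth_default // size_prod_XsubC.
apply/polyP => i.
rewrite mulrBl mulrBl coef_poly !coefB coefXM coefCM mul1r -scalerAl coefZ.
rewrite coefXM !coef_poly; case: i => [|i] /=.
  by rewrite !subn0 sp !mulr0.
rewrite subSS !ltnS.
case: (ltngtP i n) => [ltin|ltni|->].
- by rewrite -[(n - i)%N]prednK ?subn_gt0 //= subnS.
- by rewrite mulr0 subr0.
- by rewrite subnn.
Qed.

Lemma map_recip_poly (F : comNzRingType) (g : {poly int}) (s : seq F) :
  size g = (size s).+1 -> map_poly intr g = \prod_(x <- s) ('X - x%:P) ->
  map_poly intr (recip_poly g) = \prod_(x <- s) (1 - x *: 'X).
Proof.
move=> sg gE; rewrite -reverse_prod_XsubC -gE; apply/polyP => i.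
rewrite coef_map coef_poly (recip_poly_coef _ sg) ltnS.
by case: ifP => _ /=; rewrite ?coef_map // rmorph0.
Qed.

(** Conjugation fixes integer coefficients. This lets [g^*] be factored into the terms [1 - x^* X]
    that occur in Blaschke factors. *)
Lemma prod_XsubC_conj (C : numClosedFieldType) (g : {poly int}) (s : seq C) :
  map_poly intr g = \prod_(x <- s) ('X - x%:P) ->
  \prod_(x <- s) ('X - x%:P) = \prod_(x <- [seq x^* | x <- s]) ('X - x%:P).
Proof.
move=> gE; transitivity (map_poly Num.conj (\prod_(x <- s) ('X - x%:P))).
  by rewrite -gE; apply/polyP => i; rewrite !coef_map /= rmorph_int.
rewrite rmorph_prod big_map; apply: eq_bigr => x _ /=.
by rewrite rmorphB /= map_polyX map_polyC.
Qed.

(* With k the order of vanishing of g(0) g - g^* at 0, the difference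
   g(0) f - h vanishes to order exactly k, and its k-th coefficient is at least
   1/M in absolute value, because g(0) g - g^* has integer coefficients. *)
Lemma nonreciprocal_mahler_ge (C : numClosedFieldType) (g : {poly int})
    (s : seq C) :
  size g = (size s).+1 -> map_poly intr g = \prod_(x <- s) ('X - x%:P) ->
  g`_0 ^+ 2 = 1 -> g`_0 *: g != recip_poly g ->
  5 <= 4 * (\prod_(x <- s | 1 < `|x|) `|x|) ^+ 2.
Proof.
move=> sg gE e2 gN; set e := g`_0 in e2 gN.
set p := e *: g - recip_poly g.
have pN0 : p != 0 by rewrite subr_eq0.
have exk : exists k, p`_k != 0.
  by exists (size p).-1; rewrite -lead_coefE lead_coef_eq0.
case: (ex_minnP exk) => k pk kmin {exk}.
have lead1 : g`_(size s) = 1.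
  have: lead_coef (map_poly intr g : {poly C}) = 1.
    by rewrite gE (monicP (monic_prod_XsubC _ _ _)).
  rewrite lead_coefE size_map_inj_poly ?rmorph0 //; last exact: intr_inj.
  by rewrite sg /= coef_map /= => E; apply: (@intr_inj C).
(* As [g] is monic, the constant coefficient of [p] is [g(0)^2 - 1 = 0]. *)
have k_gt0 : (0 < k)%N.
  rewrite lt0n; apply: contraNneq pk => ->.
  by rewrite coefB coefZ (recip_poly_coef _ sg) subn0 lead1 -expr2 e2 subrr.
set B := fun x : C => 1 < `|x|.
(* For [|x| > 1] take [c = -x], [d = 1], with quotient [(1 - x^* X) / (X - x)]; otherwise [c = 1],
   [d = -x^*], with quotient [(X - x) / (1 - x^* X)]. *)
have Bc x : B x -> - x != 0 /\ `|1 : C| <= `|- x|.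
  move=> Bx; rewrite oppr_eq0 normrN normr1 ltW // -normr_gt0.
  by split=> //; rewrite (lt_trans ltr01).
have Sc x : ~~ B x -> (1 : C) != 0 /\ `|- x^*| <= `|1 : C|.
  by move=> Bx; rewrite oner_neq0 normrN norm_conjC normr1 real_leNgt ?realE
    ?normr_ge0 ?ler01.
have [f fD fN] := blaschke_truncation s k.+1 Sc.
have [h hD hN] := blaschke_truncation s k.+1 Bc.
move: fD hD; set D1 := \big[_/_]_(_ <- _ | _) _.
set N1 := \big[_/_]_(_ <- _ | _) _; set D2 := \big[_/_]_(_ <- _ | _) _.
set N2 := \big[_/_]_(_ <- _ | _) _.
move=> fD hD.
have gND : map_poly intr g = N1 * D2.
  rewrite gE (bigID B) /= mulrC; congr (_ * _); apply: eq_bigr => x _.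
    by rewrite rmorphN /= conjCK conjC1 scale1r polyCN addrC.
  by rewrite scale1r polyCN addrC.
have rND : map_poly intr (recip_poly g) = D1 * N2.
  rewrite (map_recip_poly (s := [seq x^* | x <- s])) ?size_map //; last first.
    by rewrite gE (prod_XsubC_conj gE).
  rewrite big_map (bigID B) /= mulrC; congr (_ * _); apply: eq_bigr => x _.
    by rewrite scaleNr.
  by rewrite conjC1 rmorphN scaleNr.
set M := \prod_(x <- s | B x) `|x|.
have D0 : (D1 * D2)`_0 = \prod_(x <- s | B x) (- x).
  rewrite -horner_coef0 hornerM !horner_prod big1 ?mul1r => [|x _].
    by apply: eq_bigr => x _; rewrite !hornerE ?mulr0 ?addr0.
  by rewrite !hornerE ?mulr0 ?addr0.
have nD0 : `|(D1 * D2)`_0| = M.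
  by rewrite D0 normr_prod; apply: eq_bigr => x _; rewrite normrN.
have M_gt0 : 0 < M.
  by apply: prodr_gt0 => x; apply: lt_trans; rewrite ltr01.
have D00 : (D1 * D2)`_0 != 0 by rewrite -normr_gt0 nD0.
set u := e%:~R *: f - h.
have pE : map_poly intr p = e%:~R *: (N1 * D2) - D1 * N2.
  by rewrite rmorphB /= map_polyZ /= gND rND.
(* Denominators are cleared in [f = N1 / D1] and [h = N2 / D2], read modulo ['X^(k.+1)]. *)
have uD : 'X^(k.+1) %| D1 * D2 * u - map_poly intr p.
  rewrite pE; have -> : D1 * D2 * u - (e%:~R *: (N1 * D2) - D1 * N2) =
    (e%:~R *: D2) * (f * D1 - N1) - D1 * (h * D2 - N2).
    by rewrite /u -!mul_polyC; ring.
  by rewrite dvdp_sub ?dvdp_mull.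
have Xp : 'X^k %| (map_poly intr p : {poly C}).
  apply/dvdXn_coef => i ik; rewrite coef_map /=.
  by have [->//|/kmin] := eqVneq p`_i 0; rewrite leqNgt ik.
have /dvdpP[v uE] : 'X^k %| u.
  have : 'X^k %| D1 * D2 * u.
    rewrite -[_ * u](subrK (map_poly intr p)) dvdp_add // (dvdp_trans _ uD) //.
    by rewrite dvdp_exp2l.
  by rewrite Gauss_dvdpr // coprimep_sym coprimep_coef0.
(* As ['X^k] divides [u], the [k]-th coefficient of [D1 * D2 * u] is [(D1 * D2)_0 u_k]; it equals
   the nonzero integer [p_k]. *)
have uk : `|u`_k| * M >= 1.
  move/dvdXn_coef/(_ k (ltnSn k))/eqP: uD; rewrite coefB subr_eq0 uE mulrA.
  rewrite !coefMXn ltnn subnn -nD0 -normrM mulrC -coef0M coef_map /= => /eqP->.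
  by rewrite -intr_norm ler1z -gtz0_ge1 normr_gt0.
have norme : `|e%:~R : C| = 1.
  apply/eqP; rewrite -sqrp_eq1 // -normrX -rmorphXn /= e2 normr1 //.
have hM : `|h`_0| * M = 1.
  have /dvdXn_coef/(_ 0 isT)/eqP := hD.
  rewrite coefB subr_eq0 coef0M -nD0 coef0M => /eqP/(congr1 Num.norm).
  have -> : D1`_0 = 1.
    by rewrite -horner_coef0 horner_prod big1 // => x _; rewrite !hornerE.
  rewrite mul1r -normrM => ->.
  rewrite -horner_coef0 horner_prod big1 ?normr1 // => x _.
  by rewrite conjC1 !hornerE.
(* Since [k > 0], [u_0 = 0], so [f_0] and [h_0] have the same modulus. *)
have fM : `|f`_0| * M = 1.
  have : u`_0 = 0 by rewrite uE coefMXn k_gt0.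
  rewrite coefB coefZ => /eqP; rewrite subr_eq0 => /eqP/(congr1 Num.norm).
  by rewrite normrM norme mul1r => ->.
(* Only the terms of index 0 and [k] of the norm are kept, scaled by [M^2]. *)
have two (q : {poly C}) : \sum_(i < k.+1) `|q`_i| ^+ 2 <= 1 ->
    `|q`_0| * M = 1 -> 1 + (`|q`_k| * M) ^+ 2 <= M ^+ 2.
  move=> qN qM; rewrite -[X in X + _](expr1n _ 2) -{1}qM !exprMn -mulrDl.
  rewrite ler_piMl ?exprn_ge0 ?(ltW M_gt0) // (le_trans _ qN) //.
  rewrite (bigD1 ord0) //= (bigD1 ord_max) //=; last by rewrite -lt0n.
  by rewrite addrA lerDl sumr_ge0 // => i _; rewrite exprn_ge0.
set a := `|f`_k| * M; set b := `|h`_k| * M.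
(* The triangle inequality for [u_k] gives [a + b >= 1]. *)
have ab : 1 <= 2 * (a ^+ 2 + b ^+ 2).
  have le1 : 1 <= a + b.
    rewrite (le_trans uk) // -mulrDl ler_wpM2r ?(ltW M_gt0) // coefB coefZ.
    by rewrite (le_trans (ler_normB _ _)) // normrM norme mul1r.
  have -> : 2 * (a ^+ 2 + b ^+ 2) = (a + b) ^+ 2 + (a - b) ^+ 2 by ring.
  rewrite -[1]addr0 lerD ?exprn_ege1 // real_exprn_even_ge0 //.
  by rewrite rpredB // realM ?normr_real // gtr0_real.
(* The sum of the two bounds is [2 + a^2 + b^2 <= 2 M^2]; doubling it yields [5 <= 4 M^2]. *)
have /(ler_wpM2l (ler0n _ 2)) := lerD (two _ fN fM) (two _ hN hM).
rewrite -/a -/b; set x := M ^+ 2.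
have -> : 2%:R * (x + x) = 4 * x by ring.
apply: le_trans.
have -> : 2%:R * (1 + a ^+ 2 + (1 + b ^+ 2)) = 4 + 2 * (a ^+ 2 + b ^+ 2).
  by ring.
have -> : (5 : C) = 4 + 1 by ring.
by rewrite lerD2l.
Qed.

(** * Nonvanishing constant coefficients *)

Section Parry.
Variables (R : realType) (beta : R).

Lemma beta_digit_ge0 i : 0 <= beta -> 0 <= beta_digit beta i.
Proof.
move=> beta0; rewrite /beta_digit floor_ge0 mulr_ge0 //.
case: i.-1 => [|k] /=; rewrite ?ler01 //.
by rewrite /beta_transform subr_ge0 Num.Theory.floor_le.
Qed.

Lemma digit_sum_coef0 (d : nat -> int) m :
  (\sum_(1 <= i < m.+2) d i *: 'X^(m.+1 - i) : {poly int})`_0 = d m.+1.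
Proof.
rewrite coef_sum big_nat_recr //= subnn coefZ coefXn mulr1 big_nat.
rewrite big1 ?add0r //.
by move=> i /andP[_ im]; rewrite coefZ coefXn eq_sym subn_eq0 leqNgt im mulr0.
Qed.

(** The constant coefficient is [-t_m] in the finite case and [-(1 + t_(p+1)) < 0] in the purely
    periodic one. In the preperiodic case it is [t_m - t_(m+p+1)]; if this were 0, the period would
    already start one index earlier. *)
Lemma parry_polynomial_coef0_neq0 N :
  0 <= beta -> parry_polynomial beta N -> N`_0 != 0.
Proof.
move=> beta0 [[|m] [] // _ tm _|[|m] p // _ [_ per minper]|p _].
- by rewrite coefB coefXn digit_sum_coef0 sub0r oppr_eq0.
- rewrite !(coefB, coefD) !coefXn addnS !digit_sum_coef0 subr0 sub0r.
  apply/eqP => tE.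
  have /minper[] : beta_periodic beta m p; last by rewrite ltnn.
  move=> i; rewrite leq_eqVlt => /predU1P[<-|/per//].
  by apply/eqP; rewrite eq_sym -subr_eq0 addrC -addSnnS addSn tE.
- rewrite !coefB coefXn coefC coef_sum big_nat big1 => [|i /andP[_ ip]].
    by rewrite subr0 sub0r oppr_eq0 gt_eqF // ltr_wpDr ?beta_digit_ge0.
  by rewrite coefZ coefXn eq_sym subn_eq0 leqNgt ip mulr0.
Qed.

End Parry.

(** Otherwise [P / X] still vanishes at [x] and has smaller degree. *)
Lemma minimal_polynomial_coef0_neq0 (F : numFieldType) (x : F)
    (P : {poly rat}) :
  x != 0 -> minimal_polynomial x P -> P`_0 != 0.
Proof.
move=> x0 [Pmonic Px Pmin]; apply/eqP => P0.
have /dvdpP[Q PE] : 'X^1 %| P by apply/dvdXn_coef => -[].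
have Q0 : Q != 0.
  by apply: contraTneq Pmonic => Q0; rewrite PE Q0 mul0r monicE lead_coef0.
have Qx : root (map_poly ratr Q) x.
  move: Px; rewrite PE rmorphM /= rootM => /orP[//|].
  by rewrite map_polyX /root hornerX (negPf x0).
by have := Pmin _ Q0 Qx; rewrite PE size_mulX // ltnn.
Qed.

(** * The numerical bound [(1 + 0.1/n)^(2n) < 5/4], and the theorem *)

(** An elementary substitute for bounding [(1 + y)^N] by an exponential. The induction uses [(1 + y)
    (1 - (N + 1) y) = 1 - N y - (N + 1) y^2]. *)
Lemma expr_1Dx_lt (F : numFieldType) (y : F) m : 0 < y ->
  (1 + y) ^+ m.+1 * (1 - m.+1%:R * y) < 1.
Proof.
move=> y0; elim: m => [|m IH].
  rewrite expr1 mul1r (_ : _ * _ = 1 - y ^+ 2); last by ring.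
  by rewrite gtrBl exprn_gt0.
apply: le_lt_trans IH; rewrite exprSr -mulrA ler_wpM2l ?exprn_ge0 //.
  by rewrite addr_ge0 // ltW.
rewrite -subr_ge0 -[m.+2%:R]natr1.
have -> : 1 - m.+1%:R * y - (1 + y) * (1 - (m.+1%:R + 1) * y) =
  m.+2%:R * y ^+ 2 by rewrite -[m.+2%:R]natr1; ring.
by rewrite mulr_ge0 // exprn_ge0 // ltW.
Qed.

Lemma house_power_lt (F : numFieldType) n : (0 < n)%N ->
  4 * ((1 + 1 / 10 / n%:R : F) ^+ n) ^+ 2 < 5.
Proof.
move=> n0; have y0 : 0 < 1 / 10 / n%:R :> F by rewrite !divr_gt0 ?ltr0n.
(* With exponent [2n] and [y = 1/(10n)], the second factor is [4/5]. *)
have := expr_1Dx_lt (n * 2).-1 y0; rewrite prednK ?muln_gt0 ?n0 // exprM.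
have -> : 1 - (n * 2)%:R * (1 / 10 / n%:R) = 4 / 5 :> F.
  by rewrite natrM; field; rewrite pnatr_eq0 -lt0n.
by rewrite mulrA ltr_pdivrMr ?ltr0n // !mul1r mulrC.
Qed.

Theorem theorem3p16 (R : realType) (beta : R) (chi : R[i]) (g : {poly int})
    (n : nat) (chis : n.-tuple R[i])
    (hbeta : parry_number beta)
    (hchi : beta_conjugate beta chi)
    (hg_monic : g \is monic)
    (hg_min : minimal_polynomial chi (map_poly intr g))
    (hg_deg : size g = n.+1)
    (hg_nonrecip : g <> recip_poly g)
    (hchis : map_poly intr g = \prod_(x <- chis) ('X - x%:P))
    (hchis0 : chis`_0 = chi) :
  (exists j : 'I_n, 1 + (1 / 10) / n%:R < `|tnth chis j|) \/
  ((forall j : 'I_n, `|tnth chis j| <= 1 + (1 / 10) / n%:R) /\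
   g = - recip_poly g).
Proof.
set y := 1 + _.
have y1 : 1 <= y by rewrite lerDl !divr_ge0 ?ler0n.
have [/existsP|/existsPn hle] := boolP [exists j, y < `|tnth chis j|].
  by left.
right.
have {}hle j : `|tnth chis j| <= y.
  by rewrite real_leNgt ?normr_real // ger0_real // (le_trans ler01).
split=> //.
(* A constant [g] would be reciprocal. *)
have n_gt0 : (0 < n)%N.
  rewrite lt0n; apply: contra_notN hg_nonrecip => /eqP n0; apply/polyP => i.
  rewrite (recip_poly_coef _ hg_deg) n0 leqn0; case: eqP => [->//|/eqP i0].
  by rewrite nth_default // hg_deg n0 lt0n.
have chi_neq0 : chi != 0.
  have [[N NP Nchi] _] := hchi; have [beta1 _ _] := hbeta.
  apply: contraTneq Nchi => ->; rewrite /root horner_coef0 coef_map /= intr_eq0.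
  by apply: parry_polynomial_coef0_neq0 NP; rewrite ltW // (lt_trans ltr01).
have g0 : g`_0 != 0.
  have := minimal_polynomial_coef0_neq0 chi_neq0 hg_min.
  by rewrite coef_map /= intr_eq0.
have hlex x : x \in chis -> `|x| <= y by case/tnthP => j ->.
have prody : \prod_(x <- chis) y = y ^+ n.
  by rewrite big_const_seq count_predT size_tuple iter_mulr_1.
have yn1 : 1 <= y ^+ n by rewrite exprn_ege1.
have yn : 4 * (y ^+ n) ^+ 2 < 5 := house_power_lt _ n_gt0.
have g0_le : `|g`_0|%:~R <= y ^+ n.
  rewrite intr_norm -coef_map /= hchis -horner_coef0 horner_prod normr_prod.
  rewrite -prody big_seq [leRHS]big_seq ler_prod // => x xs.
  by rewrite normr_ge0 !hornerE normrN hlex.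
have e2 : g`_0 ^+ 2 = 1.
  have g0_lt2 : `|g`_0| < 1 + 1.
    (* [y^n < 2] because [4 y^(2n) < 5 < 16]. *)
    rewrite -(ltr_int R[i]) (le_lt_trans g0_le) //.
    rewrite -(@ltr_pXn2r _ 2) ?nnegrE ?ler0n ?(le_trans ler01) //.
    rewrite -(@ltr_pM2l _ 4) ?ltr0n // (lt_trans yn) //.
    by rewrite -natrX -natrM ltr_nat.
  have : `|g`_0| == 1 by rewrite eq_le -ltzD1 addrC g0_lt2 -gtz0_ge1 normr_gt0.
  by rewrite -real_normK ?num_real // => /eqP->; rewrite expr1n.
have [gE|gN] := eqVneq (g`_0 *: g) (recip_poly g); last first.
  have sg : size g = (size chis).+1 by rewrite size_tuple.
  have := nonreciprocal_mahler_ge sg hchis e2 gN.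
  rewrite real_leNgt ?ger0_real ?mulr_ge0 ?exprn_ge0 ?prodr_ge0 //.
  case/negP; apply: le_lt_trans yn; rewrite ler_wpM2l //.
  rewrite lerXn2r ?nnegrE ?prodr_ge0 ?(le_trans ler01) //.
  (* Roots in the closed unit disc contribute a factor 1, which is at most [y]. *)
  rewrite -prody big_mkcond big_seq [leRHS]big_seq ler_prod // => x xs.
  by case: ifP; rewrite ?normr_ge0 ?ler01 ?y1 ?hlex.
move/eqP: e2; rewrite sqrf_eq1 => /orP[]/eqP e.
  by case: hg_nonrecip; rewrite -gE e scale1r.
by rewrite -gE e scaleN1r opprK.
Qed.
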